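(* For every integer $n\geq 2$, there is a bijection $\mathcal B_n\longrightarrow \mathcal A_{n+1}$ from the set of two-wall tableaux with $n$ columns to the set of trident tableaux with $n+1$ columns, which restricts to bijections $\mathcal B_n^{(e)}\longrightarrow \mathcal A_{n+1}^{(e)}$ for each $e\in\{0,1,2\}$. Consequently, \[ a_{n+1}^{(0)}=\binom{n}{2}C_n,\qquad a_{n+1}^{(1)}=(n-1)C_n,\qquad a_{n+1}^{(2)}=C_n, \] and $a_{n+1}=b_n=\binom{n+1}{2}C_n$, where $a_{n+1}^{(e)}=|\mathcal A_{n+1}^{(e)}|$, $a_{n+1}=|\mathcal A_{n+1}|$, $b_n=|\mathcal B_n|$, and $C_n$ is the $n$-th Catalan number.
   Context: $C_n=\frac{1}{n+1}\binom{2n}{n}$ is the $n$-th Catalan number. Column indices are counted from left to right, starting at $1$. **Trident tableaux.** For $m\geq 2$, let $\mathcal Y_m$ be the set of Young tableaux consisting of a top row and a middle row, each with $m$ cells (forming $m$ columns), together with one additional cell (the bottom cell) directly below the middle cell of one of the columns. The cells are filled bijectively with $1,2,\ldots,2m+1$, with entries increasing from left to right along each row and from bottom to top along each column (so in every column the middle entry is smaller than the top entry, and in the unique three-cell column the bottom entry is smaller than the middle entry). Let $k<j<i$ be the entries of the unique three-cell column, read from bottom to top. This column is a *trident column* if $k+1$ and $j+1$ both lie in the top row, and either $i+1$ lies in the top row or $i$ is the largest entry $2m+1$. A *trident tableau* is an element of $\mathcal Y_m$ whose unique three-cell column is a trident column; $\mathcal A_m$ denotes the set of trident tableaux in $\mathcal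 Y_m$. For $A\in\mathcal A_m$, let $c$ be the index of its trident column, let $k<j<i$ be the entries of that column read from bottom to top, and let $q$ and $s$ be the indices of the columns whose top entries are $k+1$ and $j+1$, respectively. Define \[ \mathcal A_m^{(0)}=\{A\in\mathcal A_m: q<s<c\},\quad \mathcal A_m^{(1)}=\{A\in\mathcal A_m: q<s=c=m,\ q<m-1\},\quad \mathcal A_m^{(2)}=\{A\in\mathcal A_m: q=m-1,\ s=c=m\}. \] **Two-wall tableaux.** For $n\geq2$, a *two-wall tableau* with $n$ columns is a two-row filling with $n$ columns (each row having $n$ cells) in which two distinct columns are designated as wall columns (the designation is part of the data). The cells are filled bijectively with $1,2,\ldots,2n$. The entries increase from left to right along each row and from bottom to top in every column that is not a wall column, while no vertical order is imposed in a wall column. $\mathcal B_n$ denotes the set of two-wall tableaux with $n$ columns. A column is *decreasing* if its top entry is smaller than its bottom entry (any decreasing column is necessarily a wall column). For $e\in\{0,1,2\}$, $\mathcal B_n^{(e)}$ is the subset of $\mathcal B_n$ of tableaux having exactly $e$ decreasing wall columns. *)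

(* Defs.v *)
From mathcomp Require Import all_boot.

Set Implicit Arguments.
Unset Strict Implicit.
Unset Printing Implicit Defensive.

Definition catalan (n : nat) : nat := 'C(2 * n, n) %/ n.+1.

(* The truncated quotient in [catalan] is exact. *)
Lemma catalanE (n : nat) : n.+1 * catalan n = 'C(2 * n, n).
Proof.
rewrite mulnC divnK //; have co : coprime n.+1 n by rewrite coprime_sym coprimenS.
have E : n.+1 * 'C(2 * n, n.+1) = n * 'C(2 * n, n).
  by rewrite mul_bin_left mul2n -addnn addnK.
by rewrite -(Gauss_dvdr _ co) -E dvdn_mulr.
Qed.

(* A filling of the cells [I] by 1, ..., N is a function to 'I_N = {0, ..., N-1},
   the entry of a cell being one more than its image. *)
Definition entry (I : finType) (N : nat) (T : {ffun I -> 'I_N}) (x : I) : nat :=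
  (T x).+1.

Definition bijective_filling (I : finType) (N : nat) (T : {ffun I -> 'I_N}) : bool :=
  injectiveb T && [forall y, y \in codom T].

Definition increasing (m : nat) (r : 'I_m -> nat) : bool :=
  [forall i : 'I_m, forall j : 'I_m, (i < j) ==> (r i < r j)].

(* Columns are elements of 'I_m; their indices start at 1. *)
Definition colidx (m : nat) (c : 'I_m) : nat := c.+1.

Definition bij_on (S T : finType) (f : S -> T) (X : {set S}) (Y : {set T}) : Prop :=
  {in X &, injective f} /\ f @: X = Y.

(* [Some (true, j)] and [Some (false, j)] are the top and middle cells of
   column j, and [None] is the bottom cell.  The first component of a
   [ytableau] is the column to which the bottom cell is attached. *)
Definition ycell (m : nat) : finType := option (bool * 'I_m).

Definition ytableau (m : nat) : finType :=
  ('I_m * {ffun ycell m -> 'I_(2 * m + 1)})%type.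

Definition ycol (m : nat) (A : ytableau m) : 'I_m := A.1.
Definition ytop (m : nat) (A : ytableau m) (j : 'I_m) : nat :=
  entry A.2 (Some (true, j)).
Definition ymid (m : nat) (A : ytableau m) (j : 'I_m) : nat :=
  entry A.2 (Some (false, j)).
Definition ybot (m : nat) (A : ytableau m) : nat := entry A.2 None.

Definition calY (m : nat) : {set ytableau m} :=
  [set A : ytableau m |
    [&& bijective_filling A.2, increasing (ytop A), increasing (ymid A),
        [forall j, ymid A j < ytop A j] & ybot A < ymid A (ycol A)]].

Definition in_top_row (m : nat) (A : ytableau m) (x : nat) : bool :=
  [exists j, ytop A j == x].

Definition trident_column (m : nat) (A : ytableau m) : bool :=
  let k := ybot A in
  let j := ymid A (ycol A) in
  let i := ytop A (ycol A) in
  [&& in_top_row A (k + 1), in_top_row A (j + 1)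
    & in_top_row A (i + 1) || (i == 2 * m + 1)].

Definition calA (m : nat) : {set ytableau m} :=
  [set A in calY m | trident_column A].

(* The trident tableaux for which P q s c holds, where c is the index of the
   trident column and q, s are the indices of the columns with top entries
   k+1, j+1.  On [calA m] the columns q and s exist and are unique. *)
Definition calA_where (m : nat) (P : nat -> nat -> nat -> bool) : {set ytableau m} :=
  [set A in calA m | [exists q, exists s,
    [&& ytop A q == ybot A + 1, ytop A s == ymid A (ycol A) + 1
      & P (colidx q) (colidx s) (colidx (ycol A))]]].

Definition calA0 (m : nat) : {set ytableau m} :=
  calA_where m (fun q s c => (q < s) && (s < c)).
Definition calA1 (m : nat) : {set ytableau m} :=
  calA_where m (fun q s c => [&& q < s, s == c, c == m & q < m - 1]).
Definition calA2 (m : nat) : {set ytableau m} :=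
  calA_where m (fun q s c => [&& q == m - 1, s == c & c == m]).

(* The first component is the set of wall columns; (true, j) and (false, j)
   are the top and bottom cells of column j. *)
Definition wtableau (n : nat) : finType :=
  ({set 'I_n} * {ffun bool * 'I_n -> 'I_(2 * n)})%type.

Definition walls (n : nat) (B : wtableau n) : {set 'I_n} := B.1.
Definition wtop (n : nat) (B : wtableau n) (j : 'I_n) : nat := entry B.2 (true, j).
Definition wbot (n : nat) (B : wtableau n) (j : 'I_n) : nat := entry B.2 (false, j).

Definition calB (n : nat) : {set wtableau n} :=
  [set B : wtableau n |
    [&& #|walls B| == 2, bijective_filling B.2, increasing (wtop B),
        increasing (wbot B)
      & [forall j, (j \notin walls B) ==> (wbot B j < wtop B j)]]].

Definition decreasing_column (n : nat) (B : wtableau n) (j : 'I_n) : bool :=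
  wtop B j < wbot B j.

Definition calBe (n e : nat) : {set wtableau n} :=
  [set B in calB n | #|[set j in walls B | decreasing_column B j]| == e].

(* Main.v *)
Require Import Defs.
From mathcomp Require Import all_boot zify.

Set Implicit Arguments.
Unset Strict Implicit.
Unset Printing Implicit Defensive.

(** Two-wall tableaux and trident tableaux are both counted as Dyck paths of
    semilength n carrying marks.  Matching classes turn out to have the same
    size, and a bijection that respects the classes follows from that
    ([bij_on_fibres]).

    A filling whose two rows increase is a lattice path, recorded by its
    profile y: y_0 = 0, and y_t is the number of lower-row entries smaller than
    the t-th upper-row entry.  Column t increases from bottom to top exactly
    when y_t >= t, so the decreasing columns are the flaws y_t < t.

    Two-wall side.  By the Chung-Feller theorem ([chung_feller]) there are C_n
    profiles with e flaws, for every e between 0 and n.  A two-wall tableau with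
    e decreasing columns is such a profile together with 2 - e further walls
    among the n - e other columns, whence 'C(n - e, 2 - e) * C_n of them
    ([card_calBe]).  The Chung-Feller theorem itself is a cyclic-rotation
    argument: among the n + 1 rotations of a profile the number of flaws is the
    rank of the starting point in a total order on the n + 1 positions, so it
    takes each value once; this also evaluates C_n, as there are 'C(2n, n)
    profiles.

    Trident side.  Number the columns from 1.  Without its bottom cell a
    tableau of calY_(n+1) is a Dyck profile y.  In a trident the bottom entry k
    is the immediate predecessor of the q-th top entry, so q says where k
    stands.  That j is followed by the s-th top entry means y_(s-1) < y_s = c,
    and that i is followed by a top entry or is the largest entry means that
    c = n + 1 or y_(c+1) = y_c.  Hence a trident is a triple (y, q, s) with
    q < s whose profile satisfies these two conditions on s
    ([trident_code_inj], [trident_code_onto]).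

    Now delete the trident column.  The remaining profile z equals y before s,
    y - 1 from s to c - 1, and y - 1 read one place further on from c.  It is a
    Dyck profile of semilength n, because for s <= t < c its value at t is at
    least c - 1 >= t.  Nothing is lost, as y_c = y_(c+1) is still visible and
    c = z_s + 1 (with z_(n+1) = n), and the reverse insertion applies to every
    Dyck profile z ([insert_columnK], [delete_columnK]).  So tridents correspond
    to a Dyck profile of semilength n and any pair 1 <= q < s <= n + 1
    ([card_marked_dyck]).  The three classes are s <= n, then s = n + 1 with
    q < n, then s = n + 1 with q = n, which gives the factors 'C(n, 2), n - 1
    and 1 of C_n. *)

(** * Fillings as total orders *)

Definition rank (I : finType) (K : I -> nat) (x : I) : nat :=
  #|[set z | K z < K x]|.

Lemma rank_lt_card (I : finType) (K : I -> nat) (x : I) : rank K x < #|I|.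
Proof.
rewrite -cardsT; apply: proper_card; rewrite properT.
by apply/eqP => /setP/(_ x); rewrite !inE ltnn.
Qed.

Lemma ltn_rank (I : finType) (K : I -> nat) (x z : I) :
  (rank K x < rank K z) = (K x < K z).
Proof.
case: (ltnP (K x) (K z)) => h.
  apply: proper_card; apply/properP; split; last by exists x; rewrite !inE ?ltnn.
  by apply/subsetP => w; rewrite !inE => /ltn_trans; apply.
apply/negbTE; rewrite -leqNgt; apply: subset_leq_card.
by apply/subsetP => w; rewrite !inE => /leq_trans; apply.
Qed.

Lemma rank_inj (I : finType) (K : I -> nat) : injective K -> injective (rank K).
Proof.
move=> Kinj x z e; apply: Kinj.
by case: (ltngtP (K x) (K z)) => //; rewrite -ltn_rank e ltnn.
Qed.

Lemma card_rank_eq (I : finType) (K : I -> nat) (e : nat) :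
  injective K -> e < #|I| -> #|[set x | rank K x == e]| = 1.
Proof.
move=> Kinj he; pose r x := Ordinal (rank_lt_card K x).
have rinj : injective r by move=> x z [] /(rank_inj Kinj).
have /codomP[x0 ex0] : Ordinal he \in codom r.
  by apply: inj_card_onto => //; rewrite card_ord.
have {}ex0 : rank K x0 = e by case: ex0.
rewrite (_ : [set x | _] = [set x0]) ?cards1 //.
apply/setP => x; rewrite !inE; apply/eqP/eqP => [|->//].
by rewrite -ex0 => /(rank_inj Kinj).
Qed.

(** Together with [filling_eq], this lets a bijective filling be given by its
    order alone: the entry of a cell is its rank. *)
Lemma filling_exists (I : finType) (N : nat) (K : I -> nat) :
    injective K -> #|I| = N ->
  exists T : {ffun I -> 'I_N},
    bijective_filling T /\ forall x z, (T x < T z) = (K x < K z).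
Proof.
move=> Kinj; case: N / => //; pose T := [ffun x => Ordinal (rank_lt_card K x)].
have Tinj : injective T by move=> x z; rewrite !ffunE => -[] /(rank_inj Kinj).
exists T; split; last by move=> x z; rewrite !ffunE ltn_rank.
apply/andP; split; first exact/injectiveP.
by apply/forallP => y; apply: inj_card_onto => //; rewrite card_ord.
Qed.

Lemma filling_inj (I : finType) (N : nat) (T : {ffun I -> 'I_N}) :
  bijective_filling T -> injective T.
Proof. by case/andP => /injectiveP. Qed.

Lemma filling_onto (I : finType) (N : nat) (T : {ffun I -> 'I_N}) (k : nat) :
  bijective_filling T -> k < N -> exists x, T x = k :> nat.
Proof.
case/andP => _ /forallP onto hk.
by have /codomP[x ex] := onto (Ordinal hk); exists x; rewrite -ex.
Qed.

Lemma card_ltn_ord (N k : nat) : k <= N -> #|[set i : 'I_N | i < k]| = k.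
Proof.
by move=> kN; rewrite cardsE -sum1_card (big_ord_narrow kN) sum1_card card_ord.
Qed.

Lemma filling_rank (I : finType) (N : nat) (T : {ffun I -> 'I_N}) (x : I) :
  bijective_filling T -> rank (fun z => T z : nat) x = T x.
Proof.
move=> bT; rewrite -[RHS](@card_ltn_ord N) ?(ltnW (ltn_ord _)) //.
rewrite /rank -(card_imset _ (filling_inj bT)); apply: eq_card => i; rewrite !inE.
apply/imsetP/idP => [[z]|]; first by rewrite inE => ? ->.
have [z ez] := filling_onto bT (ltn_ord i).
by move=> h; exists z; [rewrite inE ez | apply: val_inj].
Qed.

Lemma filling_eq (I : finType) (N : nat) (T T' : {ffun I -> 'I_N}) :
    bijective_filling T -> bijective_filling T' ->
  (forall x z, (T x < T z) = (T' x < T' z)) -> T = T'.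
Proof.
move=> bT bT' e; apply/ffunP => x; apply: val_inj.
rewrite /= -(filling_rank _ bT) -(filling_rank _ bT').
by apply: eq_card => z; rewrite !inE.
Qed.

(** One direction suffices, since both sides are strict orders and the order
    given by a bijective filling is total. *)
Lemma filling_order (I : finType) (N : nat) (T : {ffun I -> 'I_N}) (K : I -> nat) :
    bijective_filling T -> (forall x z, T x < T z -> K x < K z) ->
  forall x z, (T x < T z) = (K x < K z).
Proof.
move=> bT h x z; apply/idP/idP => [|hK]; first exact: h.
case: (ltngtP (T x) (T z)) => //; first by move/h; lia.
by move=> /val_inj/(filling_inj bT) e; move: hK; rewrite e ltnn.
Qed.

Lemma entry_succ (I : finType) (N : nat) (T : {ffun I -> 'I_N}) (x z : I) :
    bijective_filling T -> T z < T x -> (forall w, T w < T x -> T w <= T z) ->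
  entry T x = entry T z + 1.
Proof.
move=> bT zx h; rewrite /entry; case: (ltngtP (T z).+1 (T x)) => hlt; try lia.
have [w ew] := filling_onto bT (leq_ltn_trans zx (ltn_ord _)).
by have := h w; lia.
Qed.

Lemma entry_max (I : finType) (N : nat) (T : {ffun I -> 'I_N}) (x : I) :
  bijective_filling T -> (forall w, T w <= T x) -> entry T x = N.
Proof.
move=> bT h; rewrite /entry; have hx := ltn_ord (T x).
have [|w ew] := filling_onto (k := N.-1) bT; first by lia.
by have := h w; lia.
Qed.

(** * Profiles of lattice paths *)

Notation profile n := {ffun 'I_n.+1 -> 'I_n.+1}.
(** Evaluation at a natural number spares the arithmetic below all ordinal
    bookkeeping; it is meaningful for t <= n only, as [inord] sends larger
    numbers to 0. *)
Definition level (n : nat) (y : profile n) (t : nat) : nat := y (inord t).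
Definition mk_profile (n : nat) (f : nat -> nat) : profile n := [ffun t : 'I_n.+1 => inord (f t)].

Lemma level_ord (n : nat) (y : profile n) (t : 'I_n.+1) : level y t = y t.
Proof. by rewrite /level inord_val. Qed.

Lemma level_le (n : nat) (y : profile n) (t : nat) : level y t <= n.
Proof. by rewrite /level -ltnS ltn_ord. Qed.

Lemma level_mk (n : nat) (f : nat -> nat) (t : nat) :
  t <= n -> f t <= n -> level (mk_profile n f) t = f t.
Proof. by move=> tn fn; rewrite /level ffunE !inordK. Qed.

Lemma profile_eq (n : nat) (y z : profile n) :
  (forall t, t <= n -> level y t = level z t) -> y = z.
Proof.
move=> h; apply/ffunP => t; apply: val_inj.
by rewrite /= -!level_ord h // -ltnS.
Qed.

Definition staircases (n : nat) : {set profile n} :=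
  [set y : profile n | (y ord0 == ord0) &&
    [forall s : 'I_n.+1, forall t : 'I_n.+1, (s <= t) ==> (y s <= y t)]].

Lemma staircaseP (n : nat) (y : profile n) :
  reflect (level y 0 = 0 /\ forall s t, s <= t -> t <= n -> level y s <= level y t)
          (y \in staircases n).
Proof.
have e0 : level y 0 = y ord0 by rewrite -(level_ord y ord0).
rewrite inE; apply: (iffP andP) => [[/eqP y0 /forallP h]|[y0 h]]; split.
- by rewrite e0 y0.
- move=> s t st tn; have /forallP/(_ (inord t))/implyP := h (inord s).
  by rewrite !inordK //; [apply | lia].
- by rewrite -val_eqE /= -e0 y0.
- apply/forallP => s; apply/forallP => t; apply/implyP => st.
  by rewrite -!level_ord; apply: h => //; rewrite -ltnS.
Qed.

Definition flaws (n : nat) (y : profile n) : nat := #|[set t : 'I_n.+1 | y t < t]|.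

Definition dyck (n : nat) : {set profile n} := [set y in staircases n | flaws y == 0].

Lemma dyckP (n : nat) (y : profile n) :
  reflect [/\ level y 0 = 0, forall s t, s <= t -> t <= n -> level y s <= level y t
             & forall t, t <= n -> t <= level y t] (y \in dyck n).
Proof.
rewrite inE; apply: (iffP andP) => [[/staircaseP[y0 ym] /eqP/cards0_eq f0]|[y0 ym yd]].
  split=> // t tn; move/setP/(_ (inord t)): f0; rewrite !inE inordK //.
  by rewrite /level => /negbT; rewrite -leqNgt.
split; first exact/staircaseP.
rewrite cards_eq0; apply/eqP/setP => t; rewrite !inE; apply/negbTE.
by rewrite -leqNgt -level_ord yd // -ltnS.
Qed.

Lemma card_staircases (n : nat) : #|staircases n| = 'C(2 * n, n).
Proof.
rewrite mul2n -addnn -(card_sorted_tuples n n).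
pose f (t : n.-tuple 'I_n.+1) : profile n := [ffun i : 'I_n.+1 => nth ord0 (ord0 :: t) i].
have finj : injective f.
  move=> t t' /ffunP e; apply: val_inj; apply: (eq_from_nth (x0 := ord0)).
    by rewrite !size_tuple.
  move=> i; rewrite size_tuple => hi; have := e (Ordinal (hi : i.+1 < n.+1)).
  by rewrite !ffunE.
rewrite -(card_imset _ finj); apply: eq_card => y.
have srt (t : n.-tuple 'I_n.+1) : (f t \in staircases n) = sorted leq (map val t).
  have -> : sorted leq (map val t) = sorted leq (map val (ord0 :: t)).
    by rewrite /=; case: (tval t).
  have sz : size (map val (ord0 :: tval t)) = n.+1 by rewrite size_map /= size_tuple.
  have atE k : k <= n -> level (f t) k = nth 0 (map val (ord0 :: tval t)) k.
    move=> kn; rewrite /level ffunE inordK // (nth_map ord0) //.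
    by rewrite -(size_map val) sz.
  apply/idP/idP => [/staircaseP[_ h]|st].
    apply/(sortedP 0) => i; rewrite sz ltnS => hi.
    by rewrite -!atE ?h // ltnW.
  apply/staircaseP; split; first by rewrite atE.
  move=> i j ij jn; rewrite !atE //; last exact: leq_trans jn.
  by apply: (sorted_leq_nth leq_trans leqnn) => //; rewrite inE sz; lia.
apply/idP/imsetP => [hy|[t]]; last by rewrite inE -srt => ? ->.
pose t := [tuple y (lift ord0 j) | j < n]; have ft : f t = y.
  apply/ffunP => i; rewrite ffunE; case: (unliftP ord0 i) => [j ->|->] /=.
    by rewrite add0n (nth_map j) ?size_enum_ord // nth_ord_enum.
  by move: hy; rewrite inE => /andP[/eqP].
by exists t; rewrite ?ft // inE -srt ft.
Qed.

(** * The Chung-Feller theorem *)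

(** Extend y to all naturals by y_(t + n + 1) = y_t + n; the shift re-reads the
    extended sequence from position r and translates it to start at 0. *)
Definition shift (n : nat) (r : nat) (y : profile n) : profile n :=
  mk_profile n (fun t => if t + r <= n then level y (t + r) - level y r
                 else level y (t + r - n.+1) + n - level y r).

Lemma level_shift (n r t : nat) (y : profile n) :
    y \in staircases n -> r <= n -> t <= n ->
  level (shift r y) t = if t + r <= n then level y (t + r) - level y r
                      else level y (t + r - n.+1) + n - level y r.
Proof.
case/staircaseP=> y0 ym rn tn; rewrite level_mk //=.
have b := level_le y; case: (leqP (t + r) n) => h; first by have := b (t + r); lia.
by have := ym (t + r - n.+1) r; lia.
Qed.

Lemma shift_staircase (n r : nat) (y : profile n) :
  y \in staircases n -> r <= n -> shift r y \in staircases n.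
Proof.
move=> hy rn; have /staircaseP[y0 ym] := hy; apply/staircaseP; split.
  by rewrite level_shift // add0n rn subnn.
move=> s t st tn; rewrite !level_shift //; last exact: leq_trans tn.
have b := level_le y; case: (leqP (s + r) n) => hs; case: (leqP (t + r) n) => ht; try lia.
- by have := ym (s + r) (t + r); lia.
- by have := b (s + r); lia.
- by have := ym (s + r - n.+1) (t + r - n.+1); lia.
Qed.

(** The value y_r is recovered from the shifted sequence at n + 1 - r, where
    the wrap-around reads y_0 = 0; the other values follow. *)
Lemma shift_inj (n r : nat) :
  r <= n -> {in staircases n &, injective (shift (n := n) r)}.
Proof.
move=> rn y z hy hz e; have /staircaseP[y0 ym] := hy; have /staircaseP[z0 zm] := hz.
have key t (tn : t <= n) : level (shift r y) t = level (shift r z) t by rewrite e.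
have yn := level_le y; have zn := level_le z.
have yz0 : level y r = level z r.
  case: (posnP r) => [->|rp]; first by rewrite y0 z0.
  have := key (n.+1 - r); rewrite !level_shift //; try lia.
  have -> : n.+1 - r + r <= n = false by lia.
  have -> : n.+1 - r + r - n.+1 = 0 by lia.
  by rewrite y0 z0; have := yn r; have := zn r; lia.
apply: profile_eq => t tn; case: (leqP r t) => rt.
  have := key (t - r); rewrite !level_shift //; try lia.
  have -> : t - r + r = t by lia.
  by rewrite tn; have := ym r t; have := zm r t; lia.
have := key (t + n.+1 - r); rewrite !level_shift //; try lia.
have -> : t + n.+1 - r + r <= n = false by lia.
have -> : t + n.+1 - r + r - n.+1 = t by lia.
by have := yn r; have := zn r; lia.
Qed.

Lemma ltn_lex (M a b a' b' : nat) : b < M -> b' < M ->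
  (a * M + b < a' * M + b') = (a < a') || ((a == a') && (b < b')).
Proof.
move=> hb hb'; case: (ltngtP a a') => [h|h|->] /=; last by rewrite ltn_add2l.
  by have := leq_mul h (leqnn M); lia.
by have := leq_mul h (leqnn M); lia.
Qed.

(** The lexicographic order on (y_t - t, t), as one natural number: adding n
    keeps y_t - t nonnegative, and the base n + 1 exceeds every t. *)
Definition shift_key (n : nat) (y : profile n) (t : 'I_n.+1) : nat :=
  (level y t + (n - t)) * n.+1 + t.

Lemma shift_key_inj (n : nat) (y : profile n) : injective (shift_key y).
Proof.
move=> s t e; apply: val_inj => /=.
have := ltn_lex (level y s + (n - s)) (level y t + (n - t)) (ltn_ord s) (ltn_ord t).
have := ltn_lex (level y t + (n - t)) (level y s + (n - s)) (ltn_ord t) (ltn_ord s).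
move: e; rewrite /shift_key => ->; rewrite ltnn; lia.
Qed.

(** Position t + r is a flaw of the shift when y - id is smaller there than at
    r.  A position that wraps around has its y - id lowered by 1, so a tie counts
    as a flaw exactly for the positions before r; this is the tie-break of
    [shift_key]. *)
Lemma flaws_shift (n : nat) (y : profile n) (r : 'I_n.+1) :
  y \in staircases n -> flaws (shift r y) = rank (shift_key y) r.
Proof.
move=> hy; have /staircaseP[y0 ym] := hy; have rn := ltn_ord r.
pose g (t : 'I_n.+1) : 'I_n.+1 := inord (if t + r <= n then t + r else t + r - n.+1).
have gE (t : 'I_n.+1) : g t = (if t + r <= n then t + r else t + r - n.+1) :> nat.
  by rewrite /g inordK //; have := ltn_ord t; case: ifP; lia.
have ginj : injective g.
  move=> s t /(congr1 val) /=; rewrite !gE => e; apply: val_inj => /=.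
  by move: e; have := ltn_ord s; have := ltn_ord t; do 2 case: ifP; lia.
rewrite /flaws /rank -[RHS](card_preimset _ ginj); apply: eq_card => t; rewrite !inE.
have tn := ltn_ord t; rewrite -level_ord level_shift // /shift_key ltn_lex // gE.
have b := level_le y; case: (leqP (t + r) n) => h.
  by have := ym r (t + r); have := b (t + r); have := b r; lia.
have := ym (t + r - n.+1) r; have := b (t + r - n.+1); have := b r; lia.
Qed.

(** Counting the pairs (r, y) such that the shift of y by r has e flaws: for
    each r the shift permutes the profiles, and for each y exactly one r
    qualifies.  So n + 1 times the cardinal is the number of profiles. *)
Lemma chung_feller (n e : nat) :
  e <= n -> #|[set y in staircases n | flaws y == e]| = catalan n.
Proof.
move=> en; apply/eqP; rewrite -(eqn_pmul2l (ltn0Sn n)) catalanE -card_staircases.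
pose X := [set y in staircases n | flaws y == e]; rewrite -/X; apply/eqP.
transitivity (\sum_(r : 'I_n.+1) \sum_(y in staircases n) (flaws (shift r y) == e : nat)).
  transitivity (\sum_(r : 'I_n.+1) #|X|); first by rewrite sum_nat_const card_ord.
  apply: eq_bigr => r _.
  have rn : r <= n by rewrite -ltnS.
  rewrite -big_mkcondr /= sum1dep_card.
  (* An injective self-map of a finite set is onto. *)
  have im : shift (n := n) r @: staircases n = staircases n.
    apply/eqP; rewrite eqEcard (card_in_imset (shift_inj rn)) leqnn andbT.
    by apply/subsetP => _ /imsetP[y hy ->]; apply: shift_staircase.
  rewrite -(card_in_imset (f := shift r) (D := [set y in staircases n | flaws (shift r y) == e])).
    apply: eq_card => y; rewrite !inE; apply/idP/imsetP.
      case/andP => hy fy; have : y \in shift (n := n) r @: staircases n by rewrite im inE.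
      by case/imsetP => z hz ez; exists z => //; rewrite !inE -ez fy andbT; move: hz; rewrite inE.
    case=> z; rewrite inE => /andP[hz fz] ->; rewrite fz andbT.
    by have := shift_staircase hz rn; rewrite inE.
  by move=> y z; rewrite !inE => /andP[hy _] /andP[hz _]; apply: shift_inj => //; rewrite inE.
rewrite exchange_big /= -sum1_card; apply: eq_bigr => y hy.
rewrite -[RHS](@card_rank_eq _ (shift_key y) e) ?card_ord //; last exact: shift_key_inj.
rewrite -sum1dep_card [RHS]big_mkcond /=.
by apply: eq_bigr => r _; rewrite flaws_shift //; case: eqP.
Qed.

(** * Profiles of two-row fillings *)

Lemma ltn_increasing (m : nat) (r : 'I_m -> nat) :
  increasing r -> forall i j : 'I_m, (r i < r j) = (i < j).
Proof.
move=> /forallP inc; have h (i j : 'I_m) : i < j -> r i < r j.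
  by move: (inc i) => /forallP/(_ j)/implyP; apply.
move=> i j; apply/idP/idP => [|/h //]; case: (ltngtP i j) => //; first by move/h; lia.
by move=> /val_inj ->; rewrite ltnn.
Qed.

Lemma ltn_card_downset (m : nat) (P : pred 'I_m) :
  (forall i j : 'I_m, i <= j -> P j -> P i) ->
  forall i : 'I_m, (i < #|[set j | P j]|) = P i.
Proof.
move=> down i; case Pi: (P i).
  rewrite -(@card_ltn_ord m i.+1) ?ltn_ord //; apply: subset_leq_card.
  by apply/subsetP => j; rewrite !inE ltnS => /down; apply.
apply/negbTE; rewrite -leqNgt -[leqRHS](@card_ltn_ord m i) ?(ltnW (ltn_ord i)) //.
apply: subset_leq_card; apply/subsetP => j; rewrite !inE => Pj.
by rewrite ltnNge; apply/negP => /down/(_ Pj); rewrite Pi.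
Qed.

(** Counting the lower entries below some of the first t upper entries, rather
    than below the t-th one, makes the value 0 at t = 0 and the monotonicity in t
    hold for arbitrary rows. *)
Definition row_profile (m : nat) (top bot : 'I_m -> nat) : profile m :=
  mk_profile m (fun t => #|[set i | [exists j : 'I_m, (j < t) && (bot i < top j)]]|).

Lemma level_row_profile (m : nat) (top bot : 'I_m -> nat) (t : nat) : t <= m ->
  level (row_profile top bot) t = #|[set i | [exists j : 'I_m, (j < t) && (bot i < top j)]]|.
Proof. by move=> tm; rewrite level_mk // -[leqRHS]card_ord max_card. Qed.

Lemma row_profile_staircase (m : nat) (top bot : 'I_m -> nat) :
  row_profile top bot \in staircases m.
Proof.
apply/staircaseP; split=> [|s t st tm].
  rewrite level_row_profile //; apply/eqP; rewrite cards_eq0; apply/eqP/setP => i.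
  by rewrite !inE; apply/existsP => -[].
rewrite !level_row_profile ?(leq_trans st tm) //; apply: subset_leq_card.
apply/subsetP => i; rewrite !inE => /existsP[j /andP[js h]].
by apply/existsP; exists j; rewrite h andbT (leq_trans js).
Qed.

Lemma ltn_row_profile (m : nat) (top bot : 'I_m -> nat) (i j : 'I_m) :
    increasing top -> increasing bot ->
  (i < level (row_profile top bot) j.+1) = (bot i < top j).
Proof.
move=> /ltn_increasing tinc /ltn_increasing binc; rewrite level_row_profile //.
rewrite ltn_card_downset => [|i1 i2 i12 /existsP[k /andP[kj h]]].
  apply/existsP/idP => [[k /andP[kj h]]|h]; last by exists j; rewrite ltnSn.
  by have := tinc j k; lia.
by apply/existsP; exists k; rewrite kj; have := binc i2 i1; lia.
Qed.

(** The order of the cells of a two-row filling, read off its profile.  Keys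
    are pairs (number of lower entries weakly below, tie-break) in base 2m + 3; a
    lower cell comes first among equal first components.  The tie-breaks of the
    upper cells are even so that an extra cell can be placed immediately before
    any of them. *)
Definition cell_key (m : nat) (y : profile m) (c : bool * 'I_m) : nat :=
  if c.1 then level y c.2.+1 * (2 * m + 3) + 2 * c.2.+1 else c.2.+1 * (2 * m + 3) + 0.

Lemma ltn_cell_key (m : nat) (y : profile m) : y \in staircases m ->
  [/\ forall i j, (cell_key y (true, i) < cell_key y (true, j)) = (i < j),
      forall i j, (cell_key y (false, i) < cell_key y (false, j)) = (i < j),
      forall i j, (cell_key y (false, i) < cell_key y (true, j)) = (i < level y j.+1)
    & forall i j, (cell_key y (true, i) < cell_key y (false, j)) = (level y i.+1 <= j)].
Proof.
case/staircaseP => _ ym; split=> i j; have := ltn_ord i; have := ltn_ord j;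
  rewrite /cell_key => hj hi; rewrite ltn_lex //=; try lia.
by have := ym i.+1 j.+1; have := ym j.+1 i.+1; lia.
Qed.

Lemma cell_key_inj (m : nat) (y : profile m) :
  y \in staircases m -> injective (cell_key y).
Proof.
case/ltn_cell_key => tt ff ft tf [b i] [b' j] e.
have [l1 l2] : (cell_key y (b, i) < cell_key y (b', j)) = false
            /\ (cell_key y (b', j) < cell_key y (b, i)) = false by rewrite e ltnn.
case: b b' l1 l2 {e} => -[]; rewrite ?tt ?ff ?ft ?tf => l1 l2; try lia;
  by congr pair; apply: val_inj => /=; lia.
Qed.

Lemma cell_key_order (m : nat) (v : bool * 'I_m -> nat) :
    increasing (fun j => v (true, j)) -> increasing (fun j => v (false, j)) ->
  let y := row_profile (fun j => v (true, j)) (fun j => v (false, j)) in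
  forall c d, v c < v d -> cell_key y c < cell_key y d.
Proof.
move=> tinc binc y [b i] [b' j].
have lt i' j' := ltn_row_profile i' j' tinc binc; rewrite -/y in lt.
have [tt ff ft tf] := ltn_cell_key
  (row_profile_staircase (fun j => v (true, j)) (fun j => v (false, j))).
rewrite -/y in tt ff ft tf; have ti := ltn_increasing tinc; have bi := ltn_increasing binc.
case: b b' => -[].
- by rewrite tt -ti.
- by rewrite tf [level _ _ <= _]leqNgt lt; lia.
- by rewrite ft lt.
- by rewrite ff -bi.
Qed.

(** * Counting two-wall tableaux *)

Definition row_fillings (n : nat) : {set {ffun bool * 'I_n -> 'I_(2 * n)}} :=
  [set T : {ffun bool * 'I_n -> 'I_(2 * n)} |
    [&& bijective_filling T, increasing (fun j => entry T (true, j))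
      & increasing (fun j => entry T (false, j))]].

Definition filling_profile (n : nat) (T : {ffun bool * 'I_n -> 'I_(2 * n)}) : profile n :=
  row_profile (fun j => entry T (true, j)) (fun j => entry T (false, j)).

Lemma filling_profile_inj (n : nat) :
  {in row_fillings n &, injective (@filling_profile n)}.
Proof.
move=> T T'; rewrite !inE => /and3P[bT ti bi] /and3P[bT' ti' bi'] e.
apply: (filling_eq bT bT') => x z.
rewrite (filling_order bT (K := cell_key (filling_profile T))); last first.
  by move=> c d h; apply: (cell_key_order ti bi).
rewrite e (filling_order bT' (K := cell_key (filling_profile T'))) //.
by move=> c d h; apply: (cell_key_order ti' bi').
Qed.

Lemma row_profile_eq (m : nat) (top bot : 'I_m -> nat) (y : profile m) :
    increasing top -> increasing bot -> y \in staircases m ->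
    (forall i j, (bot i < top j) = (i < level y j.+1)) ->
  row_profile top bot = y.
Proof.
move=> ti bi hy h; have /staircaseP[y0 _] := hy.
have /staircaseP[r0 _] := row_profile_staircase top bot.
apply: profile_eq => -[|t] tm; first by rewrite r0 y0.
have lt i := ltn_row_profile i (Ordinal tm) ti bi.
have {}h i := h i (Ordinal tm); move: lt h => /=.
set a := level _ t.+1; set b := level y t.+1 => lt h.
have am : a <= m := level_le _ _; have bm : b <= m := level_le _ _.
case: (ltngtP a b) => // hlt.
  have hm : a < m by apply: leq_trans bm.
  by have := lt (Ordinal hm); rewrite h /=; lia.
have hm : b < m by apply: leq_trans am.
by have := lt (Ordinal hm); rewrite h /=; lia.
Qed.

Lemma increasing_intro (m : nat) (r : 'I_m -> nat) :
  (forall i j : 'I_m, (r i < r j) = (i < j)) -> increasing r.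
Proof. by move=> h; apply/forallP => i; apply/forallP => j; rewrite h implybb. Qed.

Lemma filling_profile_onto (n : nat) :
  @filling_profile n @: row_fillings n = staircases n.
Proof.
apply/setP => y; apply/imsetP/idP => [[T _ ->]|hy]; first exact: row_profile_staircase.
have [|T [bT oT]] := filling_exists (N := 2 * n) (cell_key_inj hy).
  by rewrite card_prod card_bool card_ord.
have [tt ff ft tf] := ltn_cell_key hy.
have ti : increasing (fun j => entry T (true, j)).
  by apply: increasing_intro => i j; rewrite /entry ltnS oT tt.
have bi : increasing (fun j => entry T (false, j)).
  by apply: increasing_intro => i j; rewrite /entry ltnS oT ff.
exists T; first by rewrite inE bT ti bi.
by apply/esym/row_profile_eq => // i j; rewrite /entry ltnS oT ft.
Qed.

Definition decreasing_set (n : nat) (T : {ffun bool * 'I_n -> 'I_(2 * n)}) : {set 'I_n} :=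
  [set j | entry T (true, j) < entry T (false, j)].

Lemma flaws_filling_profile (n : nat) (T : {ffun bool * 'I_n -> 'I_(2 * n)}) :
  T \in row_fillings n -> flaws (filling_profile T) = #|decreasing_set T|.
Proof.
rewrite inE => /and3P[bT ti bi]; rewrite -(card_imset _ (@lift_inj _ ord0)).
apply: eq_card => t; rewrite inE; case: (unliftP ord0 t) => [j|] ->.
  rewrite mem_imset; last exact: lift_inj.
  rewrite inE -level_ord lift0 ltnS leqNgt (ltn_row_profile _ _ ti bi).
  case: ltngtP => //; rewrite /entry => -[] /val_inj/(filling_inj bT) //.
by rewrite ltn0; apply/esym/imsetP => -[j _] /eqP; rewrite (negbTE (neq_lift _ _)).
Qed.

Lemma card_row_fillings (n e : nat) : e <= n ->
  #|[set T in row_fillings n | #|decreasing_set T| == e]| = catalan n.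
Proof.
move=> en; rewrite -(chung_feller en) -filling_profile_onto.
rewrite -(card_in_imset (f := @filling_profile n)); last first.
  move=> T T'; rewrite !(inE, in_setI) => /andP[h _] /andP[h' _].
  by apply: filling_profile_inj; rewrite inE.
apply: eq_card => y; rewrite inE; apply/imsetP/andP => [[T]|[/imsetP[T hT ->]]].
  rewrite inE => /andP[hT /eqP eT] ->; rewrite flaws_filling_profile // eT eqxx.
  by split=> //; apply: imset_f.
by rewrite flaws_filling_profile // => eT; exists T; rewrite // inE hT.
Qed.

Lemma card_supersets (n k : nat) (D : {set 'I_n}) : #|D| <= k ->
  #|[set W : {set 'I_n} | (#|W| == k) && (D \subset W)]| = 'C(n - #|D|, k - #|D|).
Proof.
move=> Dk; have eC : #|~: D| = n - #|D| by rewrite cardsCs setCK card_ord.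
rewrite -eC -cards_draws -[RHS](card_in_imset (f := fun W => D :|: W)); last first.
  move=> V W; rewrite !inE => /andP[hV _] /andP[hW _] /setP e; apply/setP => x.
  move: (e x) (subsetP hV x) (subsetP hW x); rewrite !inE.
  move=> ex h1 h2; apply/idP/idP => hx; move: ex; rewrite hx.
    by rewrite (negbTE (h1 hx)).
  by rewrite (negbTE (h2 hx)).
apply: eq_card => W; rewrite inE; apply/andP/imsetP => [[/eqP eW DW]|[V]].
  exists (W :\: D); last first.
    apply/setP => x; move/subsetP/(_ x): DW; rewrite !inE.
    by case: (x \in D) => //= ->.
  by rewrite inE cardsDS // eW eqxx andbT; apply/subsetP => x; rewrite !inE => /andP[].
rewrite inE => /andP[VD /eqP eV] ->; rewrite subsetUl cardsU eV; split=> //.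
have -> : D :&: V = set0.
  by apply/eqP; rewrite setI_eq0 disjoint_sym; rewrite disjoints_subset.
by rewrite cards0 subn0 subnKC.
Qed.

Lemma calBE (n : nat) (B : wtableau n) :
  (B \in calB n) =
  [&& #|walls B| == 2, B.2 \in row_fillings n & decreasing_set B.2 \subset walls B].
Proof.
rewrite inE [B.2 \in _]inE; case bT: (bijective_filling B.2); rewrite ?andbF //= -andbA.
congr andb; congr andb; congr andb; apply/forallP/subsetP => [h j|h j].
  rewrite inE => lt; apply/negPn/negP => /(implyP (h j)).
  by rewrite /wbot /wtop ltnNge (ltnW lt).
apply/implyP => nW; rewrite /wbot /wtop; case: ltngtP => //.
  by move=> lt; move: nW; rewrite h // inE.
by rewrite /entry => -[] /val_inj/(filling_inj bT).
Qed.

(** The decreasing columns are forced to be walls, so only the 2 - e other walls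
    are free. *)
Lemma card_calBe (n e : nat) : e <= 2 -> e <= n ->
  #|calBe n e| = 'C(n - e, 2 - e) * catalan n.
Proof.
move=> e2 en; rewrite -(card_row_fillings en) mulnC -sum1_card.
set X := [set T in row_fillings n | _].
have inX (B : wtableau n) : (B \in calBe n e) =
    (B.2 \in X) && (#|B.1| == 2) && (decreasing_set B.2 \subset B.1).
  rewrite inE calBE [B.2 \in X]inE /walls.
  case sub: (_ \subset _); rewrite ?andbF ?andbT //=.
  suff -> : [set j in B.1 | decreasing_column B j] = decreasing_set B.2.
    by rewrite -andbA andbC.
  apply/setP => j; rewrite !inE; apply/andb_idl => lt.
  by move/subsetP/(_ j): sub; rewrite inE; apply.
(* Sum over the filling first: each admissible one has equally many wall sets. *)
rewrite (partition_big (fun B => B.2) (fun T => T \in X)); last first.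
  by move=> B; rewrite inX -andbA => /andP[].
rewrite -sum_nat_const; apply: eq_bigr => T hT.
have eD : #|decreasing_set T| = e by move: hT; rewrite inE => /andP[_] /eqP.
rewrite sum1_card -{2 3}eD -card_supersets ?eD //.
rewrite -[RHS](card_imset _ (f := fun W => (W, T))); last by move=> V W [].
apply: eq_card => -[W T']; rewrite -topredE /= inX /=.
apply/andP/imsetP => [[/andP[/andP[_ c2] sub] /eqP <-]|[V]].
  by exists W; rewrite // inE c2.
by rewrite inE => /andP[c2 sub] [-> ->]; rewrite hT c2 sub eqxx.
Qed.

(** * Trident tableaux as marked profiles *)

(** The marks are 0-based columns, while position 0 of a profile precedes all
    columns: the value of y at column s is [level y s.+1]. *)
Notation marked n := ({ffun 'I_n.+1 -> 'I_n.+1} * ('I_n * 'I_n))%type.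

Definition trident_codes (n : nat) : {set marked n.+1} :=
  [set x : marked n.+1 | let y := level x.1 in let q := x.2.1 in let s := x.2.2 in
    [&& x.1 \in dyck n.+1, q < s, y s < y s.+1
      & (y s.+1 == n.+1) || (y (y s.+1).+1 == y (y s.+1))]].

(** The columns q and s are located by counting the top entries below k and
    below j; this is total, while only on tridents are q and s sure to exist. *)
Definition trident_code (n : nat) (A : ytableau n.+1) : marked n.+1 :=
  (row_profile (ytop A) (ymid A),
   (inord #|[set j | ytop A j < ybot A]|, inord #|[set j | ytop A j < ymid A (ycol A)]|)).

(** The bottom cell gets the odd key just below that of the top cell of column
    q, as k + 1 is the entry of the latter. *)
Definition code_key (n : nat) (x : marked n.+1) (z : ycell n.+1) : nat :=
  if z is Some c then cell_key x.1 c else level x.1 x.2.1.+1 * (2 * n.+1 + 3) + (2 * x.2.1).+1.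

Lemma card_ltn_succ (m : nat) (r : 'I_m -> nat) (v : nat) (s : 'I_m) :
    increasing r -> r s = v + 1 -> (forall j, r j != v) -> #|[set j | r j < v]| = s.
Proof.
move=> /ltn_increasing inc es nv; rewrite -[RHS](@card_ltn_ord m) ?(ltnW (ltn_ord s)) //.
by apply: eq_card => j; rewrite !inE -inc es; have := nv j; lia.
Qed.

Lemma calYP (m : nat) (A : ytableau m) :
  reflect [/\ bijective_filling A.2, increasing (ytop A), increasing (ymid A),
              (forall j, ymid A j < ytop A j) & ybot A < ymid A (ycol A)]
          (A \in calY m).
Proof.
rewrite inE; apply: (iffP and5P) => -[bT ti mi /forallP h kb]; split=> //.
Qed.

(** The profile takes the value c at column s and is smaller before, because
    exactly the first c middle entries lie below the s-th top entry j + 1. *)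
Lemma trident_codeE (n : nat) (A : ytableau n.+1) (q s : 'I_n.+1) :
    A \in calY n.+1 -> ytop A q = ybot A + 1 -> ytop A s = ymid A (ycol A) + 1 ->
  let y := row_profile (ytop A) (ymid A) in
  [/\ trident_code A = (y, (q, s)), y \in dyck n.+1, q < s,
      level y s.+1 = (ycol A).+1 & level y s < level y s.+1].
Proof.
case/calYP => bT ti mi mt kb eq es y.
have ne (c d : ycell n.+1) : c != d -> entry A.2 c != entry A.2 d.
  by apply: contra_neq => -[] /val_inj; apply: filling_inj.
have lt (i j : 'I_n.+1) : (i < level y j.+1) = (ymid A i < ytop A j) by apply: ltn_row_profile.
have tinc := ltn_increasing ti; have minc := ltn_increasing mi.
have /staircaseP[y0 ym] : y \in staircases n.+1 := row_profile_staircase _ _.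
have qs : q < s by rewrite -tinc eq es ltn_add2r.
have ys : level y s.+1 = (ycol A).+1.
  have h (i : 'I_n.+1) : (i < level y s.+1) = (i <= ycol A).
    by rewrite lt es addn1 ltnS leqNgt minc -leqNgt.
  have := h (ycol A); rewrite leqnn => h1; apply/eqP; rewrite eqn_leq h1 andbT leqNgt.
  apply/negP => h2; have hm : (ycol A).+1 < n.+1 := leq_trans h2 (level_le _ _).
  by have := h (Ordinal hm); rewrite h2 /= ltnn.
have ys' : level y s < level y s.+1.
  rewrite ys ltnS leqNgt; case: (posnP s) => [->|sp]; first by rewrite y0.
  have s1 : s.-1 < n.+1 by have := ltn_ord s; lia.
  have -> : (s : nat) = (Ordinal s1).+1 by rewrite /=; lia.
  rewrite lt -leqNgt -ltnS -[X in _ < X]addn1 -es tinc /=; lia.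
split=> //; last first.
  apply/dyckP; split=> // -[//|t] tn.
  by have := lt (Ordinal tn) (Ordinal tn); rewrite mt => ->.
have eqs (v : nat) (r : 'I_n.+1) : ytop A r = v + 1 -> (forall j, ytop A j != v) ->
    inord #|[set j | ytop A j < v]| = r.
  by move=> er nv; rewrite (card_ltn_succ ti er nv) inord_val.
by rewrite /trident_code (eqs _ q) ?(eqs _ s) // => j; apply: ne.
Qed.

Lemma calA_facts (n : nat) (A : ytableau n.+1) : A \in calA n.+1 ->
  exists q s : 'I_n.+1,
    [/\ A \in calY n.+1, ytop A q = ybot A + 1 & ytop A s = ymid A (ycol A) + 1].
Proof.
rewrite inE => /andP[hA /and3P[/existsP[q /eqP eq] /existsP[s /eqP es] _]].
by exists q, s.
Qed.

(** When i is not the largest entry, i + 1 must be the top entry of the next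
    column, and no middle entry fits between i and i + 1. *)
Lemma trident_code_in (n : nat) (A : ytableau n.+1) :
  A \in calA n.+1 -> trident_code A \in trident_codes n.
Proof.
move=> hA; have [q [s [hY eq es]]] := calA_facts hA.
have [-> dy qs ys ys'] := trident_codeE hY eq es.
rewrite inE /= dy qs ys' ys /=; have /calYP[bT ti mi mt kb] := hY.
have tinc := ltn_increasing ti.
have lt (i j : 'I_n.+1) := ltn_row_profile i j ti mi.
have /dyckP[_ ym yd] := dy.
case: (ltngtP (ycol A).+1 n.+1) => [cn|/=|e] //.
  rewrite /=; set c := ycol A in cn *; pose c' := Ordinal cn.
  have ec : ytop A c' = ytop A c + 1.
    move: hA; rewrite inE => /andP[_ /and3P[_ _ /orP[/existsP[r /eqP er]|/eqP e]]].
      have cr : c < r by rewrite -tinc er addn1.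
      have : ~~ (c' < r) by rewrite -tinc er addn1 ltnS -ltnNge tinc /=.
      rewrite -leqNgt /= => rc'; rewrite -er; congr ytop; apply: val_inj => /=; lia.
    have : ytop A c < ytop A c' by rewrite tinc.
    by rewrite e ltnNge /ytop /entry ltn_ord.
  rewrite eqn_leq [X in _ && X]ym // andbT leqNgt; apply/negP => h.
  have hi : level (row_profile (ytop A) (ymid A)) c.+1 < n.+1 := leq_trans h (level_le _ _).
  have := lt (Ordinal hi) c'; have := lt (Ordinal hi) c.
  rewrite /= h ltnn ec addn1 ltnS => h1 /esym; rewrite leq_eqVlt -h1 orbF => /eqP.
  by move=> [] /val_inj/(filling_inj bT).
by have := ltn_ord (ycol A); lia.
Qed.

Lemma code_key_order (n : nat) (A : ytableau n.+1) : A \in calA n.+1 ->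
  forall c d, (A.2 c < A.2 d) = (code_key (trident_code A) c < code_key (trident_code A) d).
Proof.
move=> hA; have [q [s [hY eq es]]] := calA_facts hA.
have [-> dy qs ys ys'] := trident_codeE hY eq es.
have /calYP[bT ti mi mt kb] := hY; apply: filling_order => //.
have tinc := ltn_increasing ti.
have lt (i j : 'I_n.+1) := ltn_row_profile i j ti mi.
have /dyckP[_ ym yd] := dy.
set y := row_profile _ _ in dy ys ys' lt ym yd *.
have qn := ltn_ord q.
move=> [c|] [d|]; last by rewrite ltnn.
- by move=> h; apply: (cell_key_order (v := fun c => entry A.2 (Some c))).
- case: c => -[] i; rewrite /code_key /cell_key /= => h; have := ltn_ord i => hi;
    rewrite ltn_lex; try lia.
    have : ytop A i < ytop A q by rewrite eq addn1 ltnS ltnW.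
    by rewrite tinc => iq; have := ym i.+1 q.+1; lia.
  have : ymid A i < ytop A q by rewrite eq addn1 ltnS ltnW.
  by rewrite -lt; lia.
- case: d => -[] i; rewrite /code_key /cell_key /= => h; have := ltn_ord i => hi;
    rewrite ltn_lex; try lia.
    have : ytop A q <= ytop A i by rewrite eq addn1.
    rewrite leqNgt tinc -leqNgt => iq; have := ym q.+1 i.+1; lia.
  have : ~~ (ymid A i < ytop A q) by rewrite eq addn1 ltnS -ltnNge.
  by rewrite -lt; lia.
Qed.

Lemma trident_code_inj (n : nat) : {in calA n.+1 &, injective (@trident_code n)}.
Proof.
move=> A A' hA hA' e.
have eT : A.2 = A'.2.
  have [_ [_ [/calYP[bT _ _ _ _] _ _]]] := calA_facts hA.
  have [_ [_ [/calYP[bT' _ _ _ _] _ _]]] := calA_facts hA'.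
  by apply: (filling_eq bT bT') => c d; rewrite !code_key_order // e.
have ec : A.1 = A'.1.
  have [q [s [hY eq es]]] := calA_facts hA; have [q' [s' [hY' eq' es']]] := calA_facts hA'.
  have [e1 _ _ ys _] := trident_codeE hY eq es.
  have [e2 _ _ ys' _] := trident_codeE hY' eq' es'.
  move: e; rewrite e1 e2 => -[ey _ ess]; apply: val_inj.
  by move: ys ys'; rewrite ey ess => -> [].
by rewrite [A]surjective_pairing eT ec -surjective_pairing.
Qed.

Lemma code_key_inj (n : nat) (x : marked n.+1) :
  x.1 \in dyck n.+1 -> injective (code_key x).
Proof.
case: x => y [q s] /= dy; have /dyckP[y0 ym yd] := dy.
have kinj : injective (cell_key y) by apply/cell_key_inj/staircaseP.
have qn := ltn_ord q.
have ne c : code_key (y, (q, s)) (Some c) != code_key (y, (q, s)) None.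
  case: c => -[] i; rewrite /code_key /cell_key /= neq_ltn; have hi := ltn_ord i.
    by rewrite !ltn_lex; lia.
  by rewrite !ltn_lex; lia.
move=> [c|] [d|] //; first by move/kinj ->.
  by move/eqP; rewrite (negbTE (ne c)).
by move/esym/eqP; rewrite (negbTE (ne d)).
Qed.

(** The tableau with a given code is the one ordered by [code_key]; its trident
    conditions hold because no key lies strictly between those of the cells
    that have to carry consecutive entries. *)
Lemma trident_code_onto (n : nat) : @trident_code n @: calA n.+1 = trident_codes n.
Proof.
apply/setP => x; apply/imsetP/idP => [[A hA ->]|]; first exact: trident_code_in.
rewrite inE; case: x => y [q s] /= /and4P[dy qs ys' end_].
have [|T [bT oT]] := filling_exists (N := 2 * n.+1 + 1) (@code_key_inj _ (y, (q, s)) dy).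
  by rewrite card_option card_prod card_bool card_ord addn1.
have /dyckP[y0 ym yd] := dy.
have st : y \in staircases n.+1 by apply/staircaseP.
have [tt ff ft tf] := ltn_cell_key st.
have sn := ltn_ord s; have qn := ltn_ord q.
have cP : (level y s.+1).-1 < n.+1 by have := level_le y s.+1; have := yd s.+1; lia.
have [c ec] : exists c : 'I_n.+1, level y s.+1 = c.+1.
  by exists (Ordinal cP) => /=; have := yd s.+1; lia.
pose A : ytableau n.+1 := (c, T).
have ltE (a b : ycell n.+1) : (entry T a < entry T b)
    = (code_key (y, (q, s)) a < code_key (y, (q, s)) b) by rewrite /entry ltnS oT.
have keyS c' : code_key (y, (q, s)) (Some c') = cell_key y c' by [].
have succ (a b : ycell n.+1) :
    code_key (y, (q, s)) b < code_key (y, (q, s)) a ->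
    (forall d, code_key (y, (q, s)) d < code_key (y, (q, s)) a ->
               code_key (y, (q, s)) d <= code_key (y, (q, s)) b) ->
    entry T a = entry T b + 1.
  move=> h1 h2; apply: entry_succ => //; first by rewrite oT.
  by move=> d; rewrite oT => /h2 le; rewrite leqNgt oT -leqNgt.
have ti : increasing (ytop A).
  by apply: increasing_intro => i j; rewrite /ytop ltE; apply: tt.
have mi : increasing (ymid A).
  by apply: increasing_intro => i j; rewrite /ymid ltE; apply: ff.
have ltq : code_key (y, (q, s)) None < code_key (y, (q, s)) (Some (false, c)).
  rewrite /code_key /cell_key ltn_lex //=; try lia.
  by have := ym q.+1 s; lia.
have hY : A \in calY n.+1.
  apply/calYP; split=> //; last by rewrite /ybot /ymid ltE.
  by move=> j; rewrite /ymid /ytop ltE; have := ft j j; rewrite yd // => /esym ->.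
have eq : ytop A q = ybot A + 1.
  by apply: succ => [|d]; rewrite /code_key /cell_key /=; lia.
have es : ytop A s = ymid A (ycol A) + 1.
  apply: succ; first by have := ft c s; rewrite ec ltnSn.
  move=> [[[] i]|] h; last exact: ltnW.
    have {h} : i < s by rewrite -tt.
    move=> si; have hi := ltn_ord i; rewrite leqNgt /code_key /cell_key ltn_lex //=; try lia.
    by have := ym i.+1 s; lia.
  have {h} : i < level y s.+1 by rewrite -ft.
  by rewrite ec ltnS => ic; rewrite leqNgt !keyS ff -leqNgt.
have [eA _ _ _ _] := trident_codeE hY eq es.
have lt (i j : 'I_n.+1) : (ymid A i < ytop A j) = (i < level y j.+1).
  by rewrite /ymid /ytop ltE; apply: ft.
have cE : ycol A = c by [].
exists A; last by rewrite eA (row_profile_eq ti mi st lt).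
rewrite inE hY andTb; apply/and3P; split.
- by apply/existsP; exists q; apply/eqP.
- by apply/existsP; exists s; apply/eqP.
case: (ltngtP c.+1 n.+1) => [cn|/=|[ecn]]; last 1 first.
- apply/orP; right; apply/eqP; apply: entry_max => // d; rewrite leqNgt oT cE.
  case: d => [[[] i]|].
  - by rewrite !keyS tt; have := ltn_ord i; lia.
  - by rewrite !keyS tf; have := ltn_ord i; have := yd c.+1; lia.
  rewrite /code_key /cell_key ltn_lex /=; try lia.
  by have := ym q.+1 c.+1; lia.
- move: end_; rewrite ec (ltn_eqF cn) /= => /eqP e.
  apply/orP; left; apply/existsP; exists (Ordinal cn); apply/eqP.
  have sc : s <= c by have := yd s.+1; lia.
  apply: succ; first by rewrite tt.
  move=> [[[] i]|] h; rewrite leqNgt.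
  - by move: h; rewrite !keyS !tt /=; lia.
  - by move: h; rewrite !keyS ft tf /= e; lia.
  rewrite /code_key /cell_key ltn_lex /=; try lia.
  by have := ym q.+1 c.+1; lia.
by have := ltn_ord c; lia.
Qed.

Lemma card_trident_codes (n : nat) (Q : pred ('I_n.+1 * 'I_n.+1)) :
  #|[set A in calA n.+1 | Q (trident_code A).2]| = #|[set x in trident_codes n | Q x.2]|.
Proof.
rewrite -trident_code_onto -[LHS](card_in_imset (f := @trident_code n)); last first.
  by move=> A A'; rewrite inE => /andP[h _]; rewrite inE => /andP[h' _]; apply: trident_code_inj.
apply: eq_card => x; rewrite [RHS]inE; apply/imsetP/andP => [[A]|[/imsetP[A hA ->]]].
  by rewrite inE => /andP[hA QA] ->; split=> //; apply: imset_f.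
by move=> QA; exists A; rewrite // inE hA.
Qed.

(** * Inserting and deleting the trident column *)

(** The column c of the trident: z_s + 1 in 1-based numbering, where z_(n+1) is
    read as n. *)
Definition trident_index (n : nat) (z : profile n) (s : nat) : nat := (level z (minn s.+1 n)).+1.

Definition insert_column (n : nat) (z : profile n) (s : nat) : profile n.+1 :=
  mk_profile n.+1 (fun t => if t <= s then level z t
    else if t <= trident_index z s then (level z (minn t n)).+1 else (level z t.-1).+1).

(** From column s on, the top entries lie above the deleted middle entry j, hence
    the predecessors.  Of the values y_c = y_(c+1) one is dropped; here it is
    y_(c+1). *)
Definition delete_column (n : nat) (y : profile n.+1) (s : nat) : profile n :=
  mk_profile n (fun t => if t <= s then level y t
    else if t <= level y s.+1 then (level y t).-1 else (level y t.+1).-1).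

Lemma level_insert_column (n : nat) (z : profile n) (s t : nat) : s <= n -> t <= n.+1 ->
  level (insert_column z s) t = if t <= s then level z t
    else if t <= trident_index z s then (level z (minn t n)).+1 else (level z t.-1).+1.
Proof.
move=> sn tn; rewrite level_mk //.
by case: ifP => _; [exact: leqW (level_le _ _) | case: ifP => _; rewrite ltnS level_le].
Qed.

Lemma insert_columnP (n : nat) (z : profile n) (s : nat) : z \in dyck n -> s <= n ->
  let y := insert_column z s in let c := trident_index z s in
  [/\ y \in dyck n.+1, level y s < level y s.+1, level y s.+1 = c, s < c
    & (c == n.+1) || (level y c.+1 == level y c)].
Proof.
move=> /dyckP[z0 zm zd] sn y c.
have atE t (tn : t <= n.+1) := level_insert_column z sn tn; rewrite -/y -/c in atE.
have zn t : level z t <= n := level_le z t.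
have sc : s < c by have := zd (minn s.+1 n); rewrite /c /trident_index; lia.
have cn : c <= n.+1 by rewrite /c /trident_index ltnS.
have ys : level y s.+1 = c by rewrite atE // ltnn sc.
split=> //.
- apply/dyckP; split; first by rewrite atE.
    move=> t1 t2 t12 t2n; rewrite !atE //; last exact: leq_trans t2n.
    case: (leqP t1 s) => h1; case: (leqP t2 s) => h2; try lia.
    - by apply: zm; lia.
    - by case: ifP => _; apply: leqW; apply: zm; lia.
    by case: ifP => h3; case: ifP => h4; rewrite ?ltnS; [apply: zm|apply: zm| |apply: zm]; lia.
  move=> t tn; rewrite atE //; have := zd t; have := zd (minn t n); have := zd t.-1.
  by do ?case: ifP; lia.
- by rewrite ys atE ?leqnn ?(leqW sn) // /c /trident_index ltnS; apply: zm; lia.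
have [->|cn'] := eqVneq c n.+1; first by rewrite ?eqxx.
rewrite !atE //=; try lia.
have -> : c.+1 <= s = false by lia.
have -> : c <= s = false by lia.
by rewrite ltnn leqnn (minn_idPl _) //; lia.
Qed.

Lemma level_delete_column (n : nat) (y : profile n.+1) (s t : nat) :
    y \in dyck n.+1 -> level y s < level y s.+1 -> s <= n -> t <= n ->
  level (delete_column y s) t = if t <= s then level y t
    else if t <= level y s.+1 then (level y t).-1 else (level y t.+1).-1.
Proof.
move=> /dyckP[y0 ym yd] ys sn tn; rewrite level_mk //.
have yn t' : level y t' <= n.+1 := level_le y t'.
have := ym t s; have := yn s.+1; have := yn t; have := yn t.+1.
by do ?case: ifP; lia.
Qed.

(** The only delicate position is t = c, where y_c - 1 >= c is needed; it holds
    because y_c = y_(c+1) >= c + 1 when c is not the last column. *)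
Lemma delete_column_dyck (n : nat) (y : profile n.+1) (s : nat) :
    y \in dyck n.+1 -> s <= n -> level y s < level y s.+1 ->
    (level y s.+1 == n.+1) || (level y (level y s.+1).+1 == level y (level y s.+1)) ->
  delete_column y s \in dyck n.
Proof.
move=> dy sn ys end_.
have atE t (tn : t <= n) := level_delete_column dy ys sn tn.
have /dyckP[y0 ym yd] := dy; have yn t : level y t <= n.+1 := level_le y t.
set c := level y s.+1 in atE ys end_.
have cn : c <= n.+1 := yn _; have sc : s < c by apply: yd.
apply/dyckP; split; first by rewrite atE.
  move=> t1 t2 t12 t2n; rewrite !atE //; last exact: leq_trans t2n.
  have ymc t : s < t -> t <= n.+1 -> c <= level y t by exact: ym.
  have yms t : t <= s -> level y t <= level y s by move=> ts; apply: ym; lia.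
  case: (leqP t1 s) => h1; case: (leqP t2 s) => h2; try lia.
  - by apply: ym; lia.
  - by have := yms t1; have := ymc t2; have := ymc t2.+1; case: ifP; lia.
  have := ym t1 t2; have := ym t1 t2.+1; have := ym t1.+1 t2.+1.
  by case: ifP => h3; case: ifP; lia.
move=> t tn; rewrite atE //; have := yd t; have := yd t.+1.
have := ym s.+1 t; rewrite -/c; case: ifP => ts; first by lia.
case: ifP; last by lia.
case: (ltngtP t c) => // [|etc]; first by lia.
by move: end_; rewrite -etc; case: eqP => [|_ /eqP]; lia.
Qed.

Lemma delete_columnK (n : nat) (y : profile n.+1) (s : nat) :
    y \in dyck n.+1 -> s <= n -> level y s < level y s.+1 ->
    (level y s.+1 == n.+1) || (level y (level y s.+1).+1 == level y (level y s.+1)) ->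
  insert_column (delete_column y s) s = y.
Proof.
move=> dy sn ys end_.
have atE t (tn : t <= n) := level_delete_column dy ys sn tn.
have /dyckP[y0 ym yd] := dy; have yn t : level y t <= n.+1 := level_le y t.
have cn : level y s.+1 <= n.+1 := yn _; have sc : s < level y s.+1 by apply: yd.
have ec : trident_index (delete_column y s) s = level y s.+1.
  rewrite /trident_index; case: (ltngtP s n) => [sn'||esn]; try lia.
    by rewrite (minn_idPl _) // atE // ltnn sc; lia.
  subst s; rewrite (minn_idPr _) ?leqnSn // atE // leqnn.
  by have := yd n; lia.
apply: profile_eq => t tn; rewrite level_insert_column // ec.
case: ifP => ts; first by rewrite atE ?ts //; lia.
set c := level y s.+1 in atE ys end_ ec cn sc *.
have ymc := ym s.+1 _; rewrite -/c in ymc.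
case: ifP => tc.
  case: (ltngtP t n.+1) => [tn'||etn]; try lia.
    by rewrite (minn_idPl _) // atE // ts tc; have := ymc t; lia.
  subst t; rewrite (minn_idPr _) ?leqnSn // atE //.
  have := yd n; have := yd n.+1; have := yn n; have := yn n.+1; have := ymc n; have := ym n s.
  by do ?case: ifP; lia.
rewrite atE; last by lia.
have -> : t.-1 <= s = false by lia.
have -> : t.-1.+1 = t by lia.
case: ifP => h; last by have := yd t; lia.
have -> : t.-1 = c by lia.
have -> : t = c.+1 by lia.
by have := yd c; move: end_; case: eqP => [|_ /eqP]; lia.
Qed.

Lemma insert_columnK (n : nat) (z : profile n) (s : nat) :
  z \in dyck n -> s <= n -> delete_column (insert_column z s) s = z.
Proof.
move=> dz sn; have [dy ys ec sc _] := insert_columnP dz sn.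
apply: profile_eq => t tn; rewrite level_delete_column // ec !level_insert_column //; try lia.
case: (leqP t s) => // ts; case: (leqP t (trident_index z s)) => tc.
  by rewrite (minn_idPl tn).
have -> : t.+1 <= s = false by lia.
by have -> : t.+1 <= trident_index z s = false by lia.
Qed.

Lemma card_marked_dyck (n : nat) (Q : pred ('I_n.+1 * 'I_n.+1)) :
  #|[set x in trident_codes n | Q x.2]|
    = #|[set p : 'I_n.+1 * 'I_n.+1 | (p.1 < p.2) && Q p]| * catalan n.
Proof.
have -> : catalan n = #|dyck n| by rewrite -(chung_feller (leq0n n)).
rewrite mulnC -cardsX; apply/esym.
pose f (x : profile n * ('I_n.+1 * 'I_n.+1)) : marked n.+1 := (insert_column x.1 x.2.2, x.2).
rewrite -(card_in_imset (f := f)); last first.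
  move=> [z p] [z' p'] /setXP[dz _] /setXP[dz' _] [e ep]; rewrite /= in dz dz' e ep.
  subst p'; congr pair; have pn : p.2 <= n by rewrite -ltnS.
  by rewrite -(insert_columnK dz pn) e insert_columnK.
apply: eq_card => -[y p]; rewrite [RHS]inE [_ \in trident_codes n]inE /=.
have pn : p.2 <= n by rewrite -ltnS.
apply/imsetP/andP => [[[z p'] /setXP[dz]]|[/and4P[dy qs ys end_] Qp]].
  rewrite inE /= => /andP[qs Qp] [-> ep]; subst p'; rewrite Qp qs; split=> //.
  by have [-> -> -> _ ->] := insert_columnP dz pn.
exists (delete_column y p.2, p); last by rewrite /f /= delete_columnK.
by apply/setXP; rewrite delete_column_dyck // inE qs.
Qed.

(** * The three classes *)

Lemma card_pairs (m : nat) (Q : pred ('I_m * 'I_m)) :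
  #|[set p : 'I_m * 'I_m | (p.1 < p.2) && Q p]|
    = \sum_(s < m) #|[set q : 'I_m | (q < s) && Q (q, s)]|.
Proof.
rewrite -sum1dep_card (eq_bigr (fun s : 'I_m => \sum_(q : 'I_m | (q < s) && Q (q, s)) 1)).
  by rewrite (exchange_big_dep xpredT) //= pair_big_dep /=; apply: eq_bigl => -[].
by move=> s _; rewrite sum1dep_card.
Qed.

Definition mark_class (n : nat) (p : 'I_n.+1 * 'I_n.+1) : nat :=
  if p.2 < n then 0 else if p.1.+1 < n then 1 else 2.

Lemma card_mark_class (n e : nat) : 0 < n ->
  #|[set p : 'I_n.+1 * 'I_n.+1 | (p.1 < p.2) && (mark_class p == e)]|
    = if e <= 2 then 'C(n - e, 2 - e) else 0.
Proof.
move=> n0; rewrite card_pairs big_ord_recr /=.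
have lo : \sum_(s < n) #|[set q : 'I_n.+1 | (q < widen_ord (leqnSn n) s)
      && (mark_class (q, widen_ord (leqnSn n) s) == e)]| = if e == 0 then 'C(n, 2) else 0.
  rewrite (eq_bigr (fun s : 'I_n => if e == 0 then s : nat else 0)) => [|s _].
    by case: ifP => _; rewrite ?sum_nat_const ?muln0 // -bin2_sum big_mkord.
  have -> : #|[set q : 'I_n.+1 | (q < widen_ord (leqnSn n) s)
      && (mark_class (q, widen_ord (leqnSn n) s) == e)]|
      = #|[set q : 'I_n.+1 | (q < s) && (e == 0)]|.
    by apply: eq_card => q; rewrite !inE /mark_class /= ltn_ord eq_sym.
  case: ifP => _; last by apply: eq_card0 => q; rewrite inE andbF.
  have sn : s <= n.+1 by have := ltn_ord s; lia.
  by rewrite -[RHS](card_ltn_ord sn); apply: eq_card => q; rewrite !inE andbT.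
rewrite {}lo; have -> : #|[set q : 'I_n.+1 | (q < @ord_max n) && (mark_class (q, @ord_max n) == e)]|
    = #|[set q : 'I_n.+1 | (q < n) && ((if q.+1 < n then 1 else 2) == e)]|.
  by apply: eq_card => q; rewrite !inE /mark_class /= ltnn.
case: e => [|[|[|e]]] /=.
- rewrite eq_card0 ?addn0 ?subn0 // => q; rewrite inE; case: ifP; rewrite andbF //.
- rewrite add0n bin1 -[RHS](@card_ltn_ord n.+1) ?(leqW (leq_subr _ _)) //.
  by apply: eq_card => q; rewrite !inE; case: ifP; lia.
- rewrite add0n bin0; have qn : n.-1 < n.+1 by lia.
  rewrite -[RHS](cards1 (Ordinal qn)); apply: eq_card => q; rewrite !inE -val_eqE /=.
  by case: ifP; lia.
by rewrite eq_card0 // => q; rewrite inE; case: ifP; rewrite andbF.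
Qed.

(** Elements of equal label are matched by their position in the enumerations of
    the two fibres. *)
Lemma bij_on_fibres (S T : finType) (X : {set S}) (Y : {set T}) (f : S -> nat) (g : T -> nat) :
    T -> (forall e, #|[set x in X | f x == e]| = #|[set y in Y | g y == e]|) ->
  exists h : S -> T, bij_on h X Y
    /\ forall e, bij_on h [set x in X | f x == e] [set y in Y | g y == e].
Proof.
move=> t0 eqc; pose FX e := enum [set x in X | f x == e]; pose FY e := enum [set y in Y | g y == e].
have eqs e : size (FX e) = size (FY e) by rewrite /FX /FY -!cardE eqc.
pose h x := nth t0 (FY (f x)) (index x (FX (f x))).
have memX x e : (x \in FX e) = (x \in X) && (f x == e) by rewrite mem_enum inE.
have memY y e : (y \in FY e) = (y \in Y) && (g y == e) by rewrite mem_enum inE.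
have idx x : x \in X -> index x (FX (f x)) < size (FY (f x)).
  by move=> hx; rewrite -eqs index_mem memX hx eqxx.
have hY x : x \in X -> (h x \in Y) && (g (h x) == f x).
  by move=> hx; rewrite -memY mem_nth ?idx.
have hinj : {in X &, injective h}.
  move=> x x' hx hx' e; have /andP[_ /eqP gx] := hY _ hx; have /andP[_ /eqP gx'] := hY _ hx'.
  have ef : f x = f x' by rewrite -gx -gx' e.
  have ix := idx _ hx; have ix' := idx _ hx'; move/eqP: e; rewrite /h; rewrite -ef in ix' *.
  rewrite nth_uniq ?enum_uniq // => /eqP e.
  by apply: (index_inj x _ _ e); rewrite memX ?hx ?hx' ?ef eqxx.
have honto y : y \in Y -> exists2 x, x \in X & h x = y /\ f x = g y.
  move=> hy; have ymem : y \in FY (g y) by rewrite memY hy eqxx.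
  have iy : index y (FY (g y)) < size (FX (g y)) by rewrite eqs index_mem.
  have [x0] : exists x0, x0 \in FX (g y).
    by case: (FX (g y)) iy => // x0 l _; exists x0; rewrite mem_head.
  move=> _; pose x := nth x0 (FX (g y)) (index y (FY (g y))).
  have : x \in FX (g y) by apply: mem_nth.
  rewrite memX => /andP[hx /eqP fx]; exists x => //; split=> //.
  by rewrite /h fx index_uniq ?enum_uniq // nth_index.
exists h; split; [split=> // | move=> e; split].
- apply/setP => y; apply/imsetP/idP => [[x hx ->]|/honto[x hx [<- _]]]; last by exists x.
  by have /andP[] := hY x hx.
- by move=> x x'; rewrite inE => /andP[hx _]; rewrite inE => /andP[hx' _]; apply: hinj.
apply/setP => y; apply/imsetP/idP => [[x]|].
  by rewrite !inE => /andP[hx /eqP <-] ->; apply: hY.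
rewrite inE => /andP[/honto[x hx [<- fx]] ey]; exists x => //.
by rewrite inE hx fx.
Qed.

(** If s = c then y_c = c, so y_(c+1) = y_c would be a flaw at c + 1: the trident
    column must be the last one.  Conversely s <= c <= n + 1 always. *)
Lemma trident_columns (n : nat) (A : ytableau n.+1) (q s : 'I_n.+1) :
    A \in calA n.+1 -> ytop A q = ybot A + 1 -> ytop A s = ymid A (ycol A) + 1 ->
  [/\ trident_code A = (row_profile (ytop A) (ymid A), (q, s)), q < s, s <= ycol A
    & (s < ycol A) = (s < n)].
Proof.
move=> hA eq es; have hY : A \in calY n.+1 by move: hA; rewrite inE => /andP[].
have [eA dy qs ys ys'] := trident_codeE hY eq es.
have := trident_code_in hA; rewrite eA inE /= => /and4P[_ _ _ end_].
have /dyckP[_ _ yd] := dy; have sn := ltn_ord s; have cn := ltn_ord (ycol A).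
have sc : s <= ycol A by have := yd s.+1; rewrite ys; lia.
split=> //; move: end_; rewrite ys => end_.
case: (ltngtP s (ycol A)) sc => // [sc|esc] _; first by lia.
apply/esym/negbTE; rewrite -leqNgt; case/orP: end_ => [|/eqP e]; first by lia.
rewrite leqNgt; apply/negP => sn'; have := yd (ycol A).+2.
by rewrite e -esc ys; lia.
Qed.

Lemma calA_whereE (n e : nat) (P : nat -> nat -> nat -> bool) :
    (forall q s c : 'I_n.+1, q < s -> s <= c -> (s < c) = (s < n) ->
       P q.+1 s.+1 c.+1 = (mark_class (q, s) == e)) ->
  calA_where n.+1 P = [set A in calA n.+1 | mark_class (trident_code A).2 == e].
Proof.
move=> h; apply/setP => A; rewrite [LHS]inE [RHS]inE.
case: (boolP (A \in calA n.+1)) => // hA; rewrite !andTb.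
apply/existsP/idP => [[q /existsP[s]]|].
  case/and3P => /eqP eq /eqP es hP; have [-> qs sc scn] := trident_columns hA eq es.
  by rewrite -(h q s (ycol A)).
have [q [s [_ eq es]]] := calA_facts hA.
have [-> qs sc scn] := trident_columns hA eq es => ecl.
by exists q; apply/existsP; exists s; rewrite eq es !eqxx /= (h q s (ycol A)).
Qed.

Theorem theorem5p1 (n : nat) (hn : 2 <= n) :
  (exists f : wtableau n -> ytableau n.+1,
     [/\ bij_on f (calB n) (calA n.+1),
         bij_on f (calBe n 0) (calA0 n.+1),
         bij_on f (calBe n 1) (calA1 n.+1)
       & bij_on f (calBe n 2) (calA2 n.+1)])
  /\ [/\ #|calA0 n.+1| = 'C(n, 2) * catalan n,
         #|calA1 n.+1| = (n - 1) * catalan n,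
         #|calA2 n.+1| = catalan n,
         #|calA n.+1| = #|calB n|
       & #|calB n| = 'C(n.+1, 2) * catalan n].
Proof.
have n0 : 0 < n by apply: leq_trans hn.
pose cl A := mark_class (@trident_code n A).2.
have E0 : calA0 n.+1 = [set A in calA n.+1 | cl A == 0].
  by apply: calA_whereE => q s c; rewrite /mark_class /colidx /=; do ?case: ifP; lia.
have E1 : calA1 n.+1 = [set A in calA n.+1 | cl A == 1].
  by apply: calA_whereE => q s c; have := ltn_ord c; rewrite /mark_class /=; do ?case: ifP; lia.
have E2 : calA2 n.+1 = [set A in calA n.+1 | cl A == 2].
  by apply: calA_whereE => q s c; have := ltn_ord c; rewrite /mark_class /=; do ?case: ifP; lia.
have cardA e : #|[set A in calA n.+1 | cl A == e]|
    = (if e <= 2 then 'C(n - e, 2 - e) else 0) * catalan n.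
  rewrite -(card_mark_class e n0) -card_marked_dyck.
  exact: (card_trident_codes (fun p => mark_class p == e)).
have t0 : ytableau n.+1 by split; [exact: ord0 | exact: [ffun=> Ordinal (ltn_addl _ (ltn0Sn 0))]].
have [|f [fb fe]] := @bij_on_fibres _ _ (calB n) (calA n.+1)
    (fun B => #|[set j in walls B | decreasing_column B j]|) cl t0.
  move=> e; rewrite cardA; case: ifP => e2.
    by rewrite -(card_calBe e2) //; apply: leq_trans hn.
  apply/eqP; rewrite cards_eq0; apply/eqP/setP => B; rewrite !inE; apply/negbTE/negP.
  case/andP=> /andP[/eqP c2 _] /eqP ce; move: e2; rewrite -ce -c2.
  by rewrite subset_leq_card //; apply/subsetP => j; rewrite inE => /andP[].
have AB : #|calA n.+1| = #|calB n|.
  by case: fb => finj <-; rewrite card_in_imset.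
split; first by exists f; rewrite E0 E1 E2; split=> //; apply: fe.
split=> //; rewrite ?E0 ?E1 ?E2 ?cardA ?subn0 ?bin1 ?bin0 ?mul1n //.
rewrite -AB; have -> : calA n.+1 = [set A in calA n.+1 | predT (trident_code A).2].
  by apply/setP => A; rewrite [RHS]inE andbT.
rewrite (card_trident_codes predT) (card_marked_dyck predT) card_pairs -bin2_sum big_mkord.
congr (_ * _); apply: eq_bigr => s _.
rewrite -[RHS](@card_ltn_ord n.+1) ?(ltnW (ltn_ord s)) //.
by apply: eq_card => q; rewrite !inE andbT.
Qed.
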